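(* If $B(1.77,p)$ is true for infinitely many primes $p$ with $p\equiv 1\pmod 4$, then Goppa's conjecture is false.
   Context: For an odd prime $p$ and a non-empty subset $S\subseteq GF(p)$ let $f_S(x)=\prod_{a\in S}(x-a)\in GF(p)[x]$, and let $X_S$ be the hyperelliptic curve $y^2=f_S(x)$. $|X_S(GF(p))|$ denotes the number of solutions $(x,y)\in GF(p)^2$ of $y^2=f_S(x)$ plus the number of points at infinity, which is $2$ if $|S|$ is even and $1$ if $|S|$ is odd. For a real number $c$, $B(c,p)$ is the statement: for all non-empty subsets $S\subseteq GF(p)$, $|X_S(GF(p))|\le c\cdot p$. Goppa's conjecture: the binary asymptotic Gilbert-Varshamov bound is best possible for any family of binary codes. Precisely, let $A_2(n,d)$ be the largest size of a binary code of length $n$ with minimum Hamming distance at least $d$, let $\alpha_2(\delta)=\limsup_{n\to\infty}\frac1n\log_2 A_2(n,\lceil\delta n\rceil)$, and let $H_2(\delta)=-\delta\log_2\delta-(1-\delta)\log_2(1-\delta)$. Goppa's conjecture asserts $\alpha_2(\delta)=1-H_2(\delta)$ for all $0<\delta<1/2$. *)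

(* Defs.v *)
From HB Require Import structures.
From mathcomp Require Import all_boot all_order all_algebra.
From mathcomp Require Import all_classical all_reals all_analysis.

Set Implicit Arguments.
Unset Strict Implicit.
Unset Printing Implicit Defensive.

Import Order.TTheory GRing.Theory Num.Theory.

Local Open Scope ring_scope.

(** Hyperelliptic curves [y ^ 2 = f_S(x)] over GF(p).  ['F_p] is GF(p) only
    when [p] is prime, so primality must accompany every use. *)

Definition fpoly (p : nat) (S : {set 'F_p}) : {poly 'F_p} :=
  \prod_(a in S) ('X - a%:P).

Definition affine_points (p : nat) (S : {set 'F_p}) : {set 'F_p * 'F_p} :=
  [set P : 'F_p * 'F_p | P.2 ^+ 2 == (fpoly S).[P.1]].

Definition points_at_infinity (p : nat) (S : {set 'F_p}) : nat :=
  if odd #|S| then 1%N else 2%N.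

Definition num_points (p : nat) (S : {set 'F_p}) : nat :=
  (#|affine_points S| + points_at_infinity S)%N.

Definition B (R : realType) (c : R) (p : nat) : Prop :=
  forall S : {set 'F_p}, S != finset.set0 -> (num_points S)%:R <= c * p%:R.

Definition hamming (n : nat) (x y : 'rV['F_2]_n) : nat :=
  #|[set i : 'I_n | x 0 i != y 0 i]|.

(** Codes with at most one word satisfy the condition for every [d]. *)
Definition min_dist_ge (n d : nat) (C : {set 'rV['F_2]_n}) : bool :=
  [forall x in C, forall y in C, (x != y) ==> (d <= hamming x y)%N].

Definition A2 (n d : nat) : nat :=
  \max_(C : {set 'rV['F_2]_n} | min_dist_ge d C) #|C|.

Definition log2 (R : realType) (x : R) : R := ln x / ln 2.

(** For [0 <= delta] the ceiling is nonnegative, so the absolute value is just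
    the conversion from [int] to [nat]. *)
Definition alpha2 (R : realType) (delta : R) : \bar R :=
  limn_esup (fun n : nat =>
    (n%:R^-1 * log2 (A2 n `|Num.ceil (delta * n%:R)|%N)%:R)%:E).

Definition H2 (R : realType) (delta : R) : R :=
  - (delta * log2 delta) - (1 - delta) * log2 (1 - delta).

Definition Goppa_conjecture (R : realType) : Prop :=
  forall delta : R, 0 < delta -> delta < 1 / 2 ->
    alpha2 delta = (1 - H2 delta)%:E.

(* Main.v *)
(** For [S] in GF(p) with [|S|] even, let [word S] be the binary word of length
    [2p] recording, at each [a], the parities of the number of [s] in [S] with
    [a - s] a nonsquare, respectively a nonzero square.  It is additive for
    symmetric differences.  The two bits differ at [a] in [S]; outside [S] they
    agree, and vanish only when [f_S(a)] is a nonzero square, that is, when two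
    affine points of [X_S] lie above [a].  Hence
    [weight + #affine points >= 2p], and [B(1.77, p)] turns the [2 ^ (p - 1)]
    even subsets into a code of length [2p], rate close to [1/2] and relative
    distance above [0.115 > 1/9].  Since [H_2(1/9) > 1/2], this beats the
    Gilbert-Varshamov bound at [delta = 1/9]. *)

Require Import Defs.
From mathcomp Require Import all_boot all_order all_algebra.
From mathcomp Require Import cyclic finfield.
From mathcomp Require Import all_classical all_reals all_analysis.
From mathcomp Require Import ring lra.

Set Implicit Arguments.
Unset Strict Implicit.
Unset Printing Implicit Defensive.

Import Order.TTheory GRing.Theory Num.Theory.

Local Open Scope ring_scope.

(** Any finite type [I] may index the coordinates: [enum_val] transports words to row vectors.
    Distinct members of [D] give distinct codewords because [d] is positive. *)
Lemma A2_lower_bound (T I : finType) (D : {set T}) (f : T -> I -> bool)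
    (d : nat) : (0 < d)%N ->
    {in D &, forall s t, s != t -> (d <= #|[set i | f s i != f t i]|)%N} ->
  (#|D| <= A2 #|I| d)%N.
Proof.
move=> d_gt0 fD.
pose w s : 'rV['F_2]_#|I| := \row_i (f s (enum_val i))%:R.
have ham s t : hamming (w s) (w t) = #|[set i | f s i != f t i]|.
  have wE i : (w s 0 i != w t 0 i) = (f s (enum_val i) != f t (enum_val i)).
    by rewrite !mxE; case: (f s _); case: (f t _).
  rewrite /hamming -(card_imset _ enum_val_inj); apply: eq_card => i.
  apply/imsetP/idP => [[j]|]; first by rewrite !inE wE => ? ->.
  rewrite inE => fi; exists (enum_rank i); last by rewrite enum_rankK.
  by rewrite inE wE enum_rankK.
have w_inj : {in D &, injective w}.
  move=> s t sD tD wst; apply/eqP/negPn/negP => /(fD _ _ sD tD).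
  rewrite -ham wst /hamming; apply/negP; rewrite -ltnNge.
  by rewrite (eq_card (B := pred0)) ?card0// => i; rewrite !inE eqxx.
rewrite -(card_in_imset w_inj); apply: (@leq_bigmax_cond _ _ (fun C : {set _} => #|C|)).
apply/forall_inP => _ /imsetP[s sD ->]; apply/forall_inP => _ /imsetP[t tD ->].
by apply/implyP => wst; rewrite ham fD//; apply: contraNneq wst => ->.
Qed.

(** * Squares in finite fields of odd order *)

Definition square (F : finFieldType) (x : F) : bool := [exists y, x == y ^+ 2].

Section Squares.
Variables (F : finFieldType) (F_odd : odd #|F|).

Lemma finField_expf_eq1 (x : F) : x != 0 -> x ^+ #|F|.-1 = 1.
Proof.
move=> x_neq0; apply: (mulfI x_neq0); rewrite mulr1 -exprS prednK ?expf_card//.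
by apply/card_gt0P; exists 0.
Qed.

Lemma finField_prim_root : exists z : F, #|F|.-1.-primitive_root z.
Proof.
suff /hasP[z _ z_prim] : has #|F|.-1.-primitive_root (enum [set~ 0 : F]) by exists z.
apply: has_prim_root; rewrite ?enum_uniq -?cardE ?cardsC1//.
  by rewrite -(cardsC1 (0 : F)); apply/card_gt0P; exists 1; rewrite !inE oner_neq0.
apply/allP => x; rewrite mem_enum !inE => x_neq0.
by apply/unity_rootP/finField_expf_eq1.
Qed.

(** With [z] a generator of the multiplicative group, [z ^+ i] is a square exactly when [i] is even.
    This parity is well defined because exponents matter only modulo the even number [#|F|.-1]. *)
Lemma squareM (x y : F) : x != 0 -> y != 0 ->
  square (x * y) = (square x == square y).
Proof.
have [z z_prim] := finField_prim_root.
have n_even : odd #|F|.-1 = false.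
  by case: #|F| F_odd => //= n /negbTE.
have zpow u : u != 0 -> exists i, u = z ^+ i.
  by move=> /finField_expf_eq1/(prim_rootP z_prim)[i ->]; exists i.
have z_neq0 : z != 0.
  apply: contra_eq_neq (prim_expr_order z_prim) => ->.
  by rewrite expr0n gtn_eqF ?(prim_order_gt0 z_prim)// eq_sym oner_neq0.
have sqz i : square (z ^+ i) = ~~ odd i.
  apply/existsP/idP => [[v /eqP zi]|/even_halfK i2].
    have [|j vj] := zpow v.
      by apply: contra_eq_neq zi => ->; rewrite expr0n/= expf_neq0.
    move/eqP: zi; rewrite vj -exprM (eq_prim_root_expr z_prim) => /eqP ij.
    by rewrite -(odd_mod i n_even) ij odd_mod// oddM andbF.
  by exists (z ^+ i./2); rewrite -exprM muln2 i2.
by move=> /zpow[i ->] /zpow[j ->]; rewrite -exprD !sqz oddD; do 2 case: odd.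
Qed.

Lemma square_prod (I : finType) (A : {set I}) (f : I -> F) :
    (forall i, i \in A -> f i != 0) ->
  ~~ square (\prod_(i in A) f i) = \big[addb/false]_(i in A) ~~ square (f i).
Proof.
move=> f_neq0.
suff [] : \prod_(i in A) f i != 0 /\
    ~~ square (\prod_(i in A) f i) = \big[addb/false]_(i in A) ~~ square (f i) by [].
apply: (big_ind2 (fun x b => x != 0 /\ ~~ square x = b)).
- split; rewrite ?oner_neq0//; apply/negbTE; rewrite negbK; apply/existsP.
  by exists 1; rewrite expr1n.
- move=> x b y c [x0 <-] [y0 <-]; split; first by rewrite mulf_neq0.
  by rewrite squareM//; do 2 case: square.
- by move=> i /f_neq0.
Qed.

End Squares.

(** * Even subsets and their words *)

Definition symdiff (T : finType) (A B : {set T}) : {set T} :=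
  [set x | (x \in A) (+) (x \in B)].

Lemma big_addb_symdiff (T : finType) (A B : {set T}) (b : T -> bool) :
  \big[addb/false]_(x in symdiff A B) b x =
  \big[addb/false]_(x in A) b x (+) \big[addb/false]_(x in B) b x.
Proof.
rewrite big_mkcond [X in X (+) _]big_mkcond [X in _ (+) X]big_mkcond -big_split.
by apply: eq_bigr => x _; rewrite inE; case: (x \in A) (x \in B) (b x) => [] [] [].
Qed.

Lemma odd_card_big (T : finType) (A : {set T}) :
  odd #|A| = \big[addb/false]_(x in A) true.
Proof. by rewrite -sum1_card (big_morph odd oddD (erefl : odd 0 = false)). Qed.

Lemma odd_symdiff (T : finType) (A B : {set T}) :
  odd #|symdiff A B| = odd #|A| (+) odd #|B|.
Proof. by rewrite !odd_card_big big_addb_symdiff. Qed.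

(** Toggling membership of [x0] injects the odd subsets into the even ones. *)
Lemma card_even_subsets (T : finType) (x0 : T) :
  (2 ^ #|T|.-1 <= #|[set A : {set T} | ~~ odd #|A|]|)%N.
Proof.
set E := [set A | _].
have T_gt0 : (0 < #|T|)%N by apply/card_gt0P; exists x0.
pose tg (A : {set T}) := symdiff [set x0] A.
have tgK : involutive tg by move=> A; apply/setP => x; rewrite !inE addKb.
have : (#|~: E| <= #|E|)%N.
  rewrite -(card_imset _ (inv_inj tgK)); apply/subset_leq_card/fintype.subsetP.
  by move=> _ /imsetP[A + ->]; rewrite !inE negbK odd_symdiff cards1 => ->.
rewrite -(leq_add2l #|E|) cardsC addnn -mul2n.
have -> : #|{: {set T}}| = (2 ^ #|T|)%N by rewrite -[in RHS]cardsT -card_powerset powersetT cardsT.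
by rewrite -[in X in (X <= _)%N](prednK T_gt0) expnS leq_pmul2l.
Qed.

(** As [square 0] holds, [s = a] contributes nothing to the left bit; the right bit excludes it
    explicitly. *)
Definition word (F : finFieldType) (S : {set F}) (i : F + F) : bool :=
  match i with
  | inl a => \big[addb/false]_(s in S) ~~ square (a - s)
  | inr a => \big[addb/false]_(s in S) (square (a - s) && (a != s))
  end.

Arguments word : simpl never.

Lemma word_symdiff (F : finFieldType) (S T : {set F}) i :
  word (symdiff S T) i = word S i (+) word T i.
Proof. by case: i => a; apply: big_addb_symdiff. Qed.

(** Each difference [a - s] is a nonsquare, a nonzero square or zero, so the two bits and the
    indicator of [a \in S] add up to the parity of [#|S|]. *)
Lemma word_even (F : finFieldType) (S : {set F}) (a : F) : ~~ odd #|S| ->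
  word S (inl a) (+) word S (inr a) = (a \in S).
Proof.
move=> Seven; rewrite /word -big_split/=.
have -> : (a \in S) = odd #|S| (+) \big[addb/false]_(s in S) (a == s).
  rewrite (negbTE Seven) addFb; have [aS|aS] := boolP (a \in S).
    rewrite (bigD1 a)//= eqxx big1// => s /andP[_ /negbTE].
    by rewrite eq_sym.
  by rewrite big1// => s sS; apply: contraNF aS => /eqP ->.
rewrite odd_card_big -big_split; apply: eq_bigr => s _ /=.
have [<-|_] := eqVneq a s; last by rewrite andbT; case: square.
suff -> : square (a - a) by [].
by apply/existsP; exists 0; rewrite subrr expr0n.
Qed.

Lemma card_word (F : finFieldType) (S : {set F}) :
  #|[set i | word S i]| = (\sum_a (word S (inl a) + word S (inr a)))%N.
Proof.
rewrite big_split -sum1dep_card big_sumType.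
by congr (_ + _)%N; rewrite big_mkcond; apply: eq_bigr => a _; case: (word _ _).
Qed.

(** * Weights of words against points on the curve *)

Section Weight.
Variables (p : nat) (p_prime : prime p) (p_odd : odd p).

Lemma Fp_odd : odd #|'F_p|. Proof. by rewrite card_Fp. Qed.

Lemma card_affine_points (S : {set 'F_p}) :
  #|affine_points S| = (\sum_a #|[set y | y ^+ 2 == (fpoly S).[a]]|)%N.
Proof.
rewrite -sum1dep_card -(pair_big_dep xpredT (fun a y => y ^+ 2 == (fpoly S).[a]) (fun _ _ => 1%N))/=.
by apply: eq_bigr => a _; rewrite sum1dep_card.
Qed.

Lemma weight_lower_bound (S : {set 'F_p}) : ~~ odd #|S| ->
  (p + p <= #|[set i | word S i]| + #|affine_points S|)%N.
Proof.
move=> Seven; rewrite card_word card_affine_points -big_split.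
have -> : (p + p = \sum_(a : 'F_p) 2)%N by rewrite sum_nat_const card_Fp// muln2 addnn.
apply: leq_sum => a _.
have fE : (fpoly S).[a] = \prod_(s in S) (a - s).
  by rewrite horner_prod; apply: eq_bigr => s _; rewrite hornerXsubC.
have := word_even a Seven.
have [aS|aS] := boolP (a \in S).
  have : (0 < #|[set y | y ^+ 2 == (fpoly S).[a]]|)%N.
    apply/card_gt0P; exists 0; rewrite inE expr0n fE eq_sym; apply/eqP.
    by rewrite (bigD1 a)//= subrr mul0r.
  (* Exactly one bit is set, and the point with [y = 0] supplies the other unit. *)
  by case: (word _ (inl a)) (word _ (inr a)) => [] [] //= c_gt0 _; exact: c_gt0.
(* Two set bits already suffice; two zero bits require two points above [a], namely [y] and
   [- y]. *)
case wl: (word _ (inl a)); case: (word _ (inr a)) => //= _.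
have f_neq0 s : s \in S -> a - s != 0.
  by move=> sS; rewrite subr_eq0; apply: contraNneq aS => ->.
have /negbT := wl; rewrite /word -(square_prod Fp_odd f_neq0) negbK -fE.
case/existsP => y /eqP fy.
have fa_neq0 : (fpoly S).[a] != 0 by rewrite fE; apply/prodf_neq0.
have y_neq0 : y != 0 by apply: contraNneq fa_neq0 => y0; rewrite fy y0 expr0n.
apply: (@leq_trans #|[set y; - y]|).
  rewrite cards2 -addr_eq0 -mulr2n -mulr_natr mulf_eq0 (negbTE y_neq0)/=.
  suff -> : (2%:R : 'F_p) != 0 by [].
  rewrite -(dvdn_pcharf (pchar_Fp p_prime)); apply/negP => /dvdn_leq.
  by case: p p_odd p_prime => [|[|[|q]]] // _ _ /(_ isT).
by apply/subset_leq_card/fintype.subsetP => x; rewrite !inE => /orP[] /eqP ->; rewrite ?sqrrN fy.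
Qed.

(** Here [23 / 100] is [2 - 177 / 100], and the [+ 1] is gained from a point at infinity; it will
    absorb the rounding of a ceiling. *)
Lemma A2_double_prime (R : realType) (d : nat) : (0 < d)%N ->
    @B R (177 / 100) p -> (d%:R <= 23 / 100 * p%:R + 1 :> R) ->
  (2 ^ p.-1 <= A2 (p + p) d)%N.
Proof.
move=> d_gt0 Bp dp.
have cardp : #|{: 'F_p + 'F_p}| = (p + p)%N by rewrite card_sum card_Fp.
rewrite -cardp -[in X in (X <= _)%N](card_Fp p_prime).
apply: leq_trans (card_even_subsets (0 : 'F_p)) _.
apply: (A2_lower_bound (f := @word 'F_p)) => // S T; rewrite !inE => Seven Teven ST.
(* By additivity, the distance between two words is the weight of a third, again from an even
   subset. *)
rewrite (eq_card (B := [set i | word (symdiff S T) i])); last first.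
  by move=> i; rewrite !inE word_symdiff; do 2 case: word.
have /weight_lower_bound : ~~ odd #|symdiff S T|.
  by rewrite odd_symdiff (negbTE Seven).
have /Bp : symdiff S T != finset.set0.
  apply: contraNneq ST => /setP ST0; apply/eqP/setP => x.
  by have := ST0 x; rewrite !inE; do 2 case: (x \in _).
rewrite /num_points -!(ler_nat R) !natrD; set w := #|_|%:R; set m := #|_|%:R.
have : 1 <= (points_at_infinity (symdiff S T))%:R :> R.
  by rewrite ler1n /points_at_infinity; case: ifP.
lra.
Qed.

End Weight.

(** * Limit superior and comparison with the Gilbert-Varshamov bound *)

Lemma le_limn_esup (R : realType) (u : (\bar R)^nat) (c : \bar R) :
  (forall N, exists2 n, (N <= n)%N & (c <= u n)%E) -> (c <= limn_esup u)%E.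
Proof.
move=> cu; apply/ereal_infP => _ [V /= [N _ NV] <-].
have [n Nn cn] := cu N; apply: le_trans cn _; apply: ereal_sup_ubound.
by exists n => //; apply: NV.
Qed.

Lemma infinite_set_nat_unbounded (A : set nat) : infinite_set A ->
  forall N, exists2 n, (N <= n)%N & A n.
Proof.
move=> Ainf N; apply: contrapT => noA; apply: Ainf.
apply: (sub_finite_set (B := `I_N)) (finite_II N) => n An /=.
by rewrite ltnNge; apply/negP => Nn; apply: noA; exists n.
Qed.

(* [H2 (1 / 9) = log2 9 - 8 / 3], so this is [9 ^ 6 = 531441 > 524288 = 2 ^ 19]. *)
Lemma H2_ninth (R : realType) : 1 / 2 < H2 (1 / 9 : R).
Proof.
have ln2_gt0 : 0 < ln 2 :> R by rewrite ln_gt0// ltr1n.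
have ln_lt : ln 2 *+ 19 < ln 9 *+ 6 :> R.
  rewrite -!lnXn// ltr_ln ?posrE ?exprn_gt0//.
  have two6 : 2 ^+ 6 = 64 :> R by rewrite !exprS expr0; lra.
  have nine2 : 9 ^+ 2 = 81 :> R by rewrite !exprS expr0; lra.
  by rewrite (exprS 2 18) (exprM 2 6 3) (exprM 9 2 3) two6 nine2 !exprS expr0; lra.
rewrite /H2 /log2.
have -> : 1 - 1 / 9 = 2 ^+ 3 / 9 :> R by lra.
rewrite !ln_div ?posrE ?exprn_gt0// ln1 lnXn//.
(* Left in place, [ln 2] and [ln 9] make [field] and [lra] diverge, apparently by
   unfolding them to compare them. *)
move: (ln 2) (ln 9) ln2_gt0 ln_lt => l L l_gt0 lL.
have -> : - (1 / 9 * ((0 - L) / l)) - 2 ^+ 3 / 9 * ((l *+ 3 - L) / l) =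
    L / l - 8 / 3 :> R.
  by field; rewrite gt_eqF.
suff : 19 / 6 < L / l :> R by lra.
by rewrite ltr_pdivlMr//; lra.
Qed.

Local Open Scope classical_set_scope.

Theorem theorem2 (R : realType)
  (hB : infinite_set
          [set p : nat | [/\ prime p, p = 1 %[mod 4] & @B R (177 / 100) p]]) :
  ~ Goppa_conjecture R.
Proof.
move=> /(_ (1 / 9) ltac:(lra) ltac:(lra)) goppa.
have H2_gt := H2_ninth R.
(* The conjectured value at [1 / 9] is [1 / 2 - e]; codes of rate at least [1 / 2 - e / 2] at
   arbitrarily large lengths exceed it. *)
set e : R := H2 (1 / 9) - 1 / 2.
have e_gt0 : 0 < e by rewrite /e; lra.
suff : ((1 / 2 - e / 2)%:E <= alpha2 (1 / 9 : R))%E by rewrite goppa lee_fin /e; lra.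
apply: le_limn_esup => N.
(* The rate [(p - 1) / (2 * p)] falls short of [1 / 2] by [1 / (2 * p)], which is at most [e / 2]
   once [p] is at least [e^-1]. *)
have [p Np [p_prime p4 Bp]] :=
  infinite_set_nat_unbounded hB (maxn N `|Num.ceil e^-1|%N).
have p_odd : odd p by rewrite -(odd_mod p (erefl : odd 4 = false)) p4.
exists (p + p)%N.
  by rewrite (leq_trans _ (leq_addr _ _))// (leq_trans (leq_maxl _ _) Np).
have p_gt0 : 0 < p%:R :> R by rewrite ltr0n prime_gt0.
have p_ge : e^-1 <= p%:R.
  apply: le_trans (ceil_ge _) _.
  rewrite (le_trans (ler_norm _))// -intr_norm -natr_absz ler_nat.
  exact: leq_trans (leq_maxr _ _) Np.
set x : R := 1 / 9 * (p + p)%:R.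
have x_gt0 : 0 < x by rewrite /x natrD; lra.
have /andP[x_gt _] := ceil_itv x.
set d := `|Num.ceil x|%N.
have ceil_x_gt0 : 0 < Num.ceil x by rewrite ceil_gt0.
have d_gt0 : (0 < d)%N by rewrite absz_gt0 gt_eqF.
(* The ceiling is below [2 / 9 * p + 1], and [2 / 9 < 23 / 100]. *)
have dp : d%:R <= 23 / 100 * p%:R + 1 :> R.
  rewrite /d natr_absz gtr0_norm//; move: x_gt; rewrite intrB /x natrD; lra.
have := A2_double_prime p_prime p_odd d_gt0 Bp dp.
rewrite -(ler_nat R) natrX => A2_ge.
have ln2_gt0 : 0 < ln 2 :> R by rewrite ln_gt0// ltr1n.
have log_ge : p%:R - 1 <= log2 (A2 (p + p) d)%:R :> R.
  have -> : p%:R - 1 = p.-1%:R :> R by rewrite -subn1 natrB ?prime_gt0.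
  rewrite /log2 ler_pdivlMr//.
  rewrite mulr_natl -lnXn// ler_ln ?posrE ?exprn_gt0//.
  by rewrite (lt_le_trans _ A2_ge)// exprn_gt0.
have ep_ge1 : 1 <= e * p%:R.
  by rewrite -ler_pdivrMl// mulr1.
rewrite lee_fin -/x -/d ler_pdivlMl; last by rewrite natrD addr_gt0.
by apply: le_trans log_ge; rewrite natrD; lra.
Qed.
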